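(* Let $\mathbb{F}$ be a division ring, $\sigma:\mathbb{F}\to\mathbb{F}$ a ring endomorphism, $\delta:\mathbb{F}\to\mathbb{F}$ a $\sigma$-derivation, and $\mathcal{R}=\mathbb{F}[x;\sigma,\delta]$. Let $f,g\in\mathcal{R}$ be two skew polynomials of non-negative degrees $m$ and $n$, respectively. The following properties hold: 1) $R^{\sigma,\delta}_{\mathbb{F}}(g,f)=(-1)^{mn}R^{\sigma,\delta}_{\mathbb{F}}(f,g)$; 2) $R^{\sigma,\delta}_{\mathbb{F}}(-f,g)=(-1)^{n}R^{\sigma,\delta}_{\mathbb{F}}(f,g)$ and $R^{\sigma,\delta}_{\mathbb{F}}(f,-g)=(-1)^{m}R^{\sigma,\delta}_{\mathbb{F}}(f,g)$; 3) if $g=x-a$ with $a\in\mathbb{F}$, then $R^{\sigma,\delta}_{\mathbb{F}}(f,g)=0$ if and only if $f(a)=0$; in particular, for $a=0$, $R^{\sigma,\delta}_{\mathbb{F}}(f,g)=f(0)\ (\mathrm{mod}\ [\mathbb{F}^*,\mathbb{F}^*])$; 4) if $g=b_0$ (a non-zero constant), then $R^{\sigma,\delta}_{\mathbb{F}}(f,g)=b_0\sigma(b_0)\sigma^2(b_0)\cdots\sigma^{m-1}(b_0)\ (\mathrm{mod}\ [\mathbb{F}^*,\mathbb{F}^*])$; 5) if $\delta=0$ and $c\in\mathbb{F}^*$, then $R^{\sigma,0}_{\mathbb{F}}(cf,g)=\big(N_n^{\sigma,0}(c)\ (\mathrm{mod}\ [\mathbb{F}^*,\mathbb{F}^*])\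big)\,R^{\sigma,0}_{\mathbb{F}}(f,g)$.
   Context: A $\sigma$-derivation is an additive map $\delta:\mathbb{F}\to\mathbb{F}$ with $\delta(ab)=\sigma(a)\delta(b)+\delta(a)b$ for all $a,b\in\mathbb{F}$ ($\sigma$ a non-zero ring endomorphism). The skew polynomial ring $\mathcal{R}=\mathbb{F}[x;\sigma,\delta]$ is the set of polynomials $\sum_i a_ix^i$ ($a_i\in\mathbb{F}$) with usual addition and multiplication determined by $xa=\sigma(a)x+\delta(a)$ for $a\in\mathbb{F}$. The (right) evaluation $f(a)\in\mathbb{F}$ of $f\in\mathcal{R}$ at $a\in\mathbb{F}$ is the unique remainder of the right division of $f$ by $x-a$, i.e. $f(x)=q(x)(x-a)+f(a)$. Define $N_0^{\sigma,\delta}(a)=1$ and $N_i^{\sigma,\delta}(a)=\sigma(N_{i-1}^{\sigma,\delta}(a))a+\delta(N_{i-1}^{\sigma,\delta}(a))$; so $N_n^{\sigma,0}(c)=\sigma^{n-1}(c)\cdots\sigma(c)c$. Right $(\sigma,\delta)$-resultant: for $f=\sum_{i=0}^m a_ix^i$ and $g=\sum_{j=0}^n b_jx^j$ of degrees $m,n\ge0$, the right $(\sigma,\delta)$-Sylvester matrix $\mathrm{Sylv}^{\sigma,\delta}_{\mathbb{F}}(f,g)$ is the $(m+n)\times(m+n)$ matrix over $\mathbb{F}$ whose rows are, in order, the vectors of left coefficients with respect to $1,x,\dots,x^{m+n-1}$ of $f,xf,\dots,x^{n-1}f,g,xg,\dots,x^{m-1}g$. The resultant $R^{\sigma,\delta}_{\mathbb{F}}(f,g)$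 is its Dieudonné determinant, with values in $\{0\}\cup\mathbb{F}^*/[\mathbb{F}^*,\mathbb{F}^*]$. Here $[\mathbb{F}^*,\mathbb{F}^*]$ is the commutator subgroup of $\mathbb{F}^*=\mathbb{F}\setminus\{0\}$; for $a\in\mathbb{F}$, $a\ (\mathrm{mod}\ [\mathbb{F}^*,\mathbb{F}^*])$ denotes the coset $a[\mathbb{F}^*,\mathbb{F}^*]$ if $a\neq0$ and $0$ if $a=0$; signs $(-1)^k$ act through their cosets. *)

(* Defs.v *)
From HB Require Import structures.
From mathcomp Require Import all_boot all_order fingroup perm all_algebra.
From mathcomp Require Import boolp.

Set Implicit Arguments.
Unset Strict Implicit.
Unset Printing Implicit Defensive.

Import GRing.Theory.
Local Open Scope ring_scope.
Local Open Scope quotient_scope.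

HB.mixin Record UnitRing_isDivRing F of GRing.UnitRing F := {
  divring_unit : forall x : F, x != 0 -> x \is a GRing.unit
}.

#[short(type="divRingType")]
HB.structure Definition DivRing := {F of GRing.UnitRing F & UnitRing_isDivRing F}.

Section DivRingTheory.
Variable F : divRingType.
Implicit Types a b c : F.

Lemma dunitE a : (a \is a GRing.unit) = (a != 0).
Proof.
apply/idP/idP; last exact: divring_unit.
by apply: contraTneq => ->; rewrite unitr0.
Qed.

Lemma dmulf_neq0 a b : a != 0 -> b != 0 -> a * b != 0.
Proof. by rewrite -!dunitE => ua ub; rewrite unitrMl. Qed.

Lemma dinv_neq0 a : a != 0 -> a^-1 != 0.
Proof. by rewrite -!dunitE unitrV. Qed.

(* [F^*, F^*] *)
Inductive commutator_subgroup : F -> Prop :=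
| comm_sub1 : commutator_subgroup 1
| comm_subR a b : a != 0 -> b != 0 ->
    commutator_subgroup (a * b * a^-1 * b^-1)
| comm_subM a b : commutator_subgroup a -> commutator_subgroup b ->
    commutator_subgroup (a * b)
| comm_subV a : commutator_subgroup a -> commutator_subgroup a^-1.

Lemma comm_sub_neq0 c : commutator_subgroup c -> c != 0.
Proof.
elim=> [|a b a0 b0|a b _ a0 _ b0|a _ a0]; rewrite ?oner_neq0 ?dinv_neq0 //;
by do ?apply: dmulf_neq0 => //; apply: dinv_neq0.
Qed.

Lemma comm_subJ a c : a != 0 ->
  commutator_subgroup c -> commutator_subgroup (a * c * a^-1).
Proof.
move=> a0 Hc; have c0 := comm_sub_neq0 Hc.
rewrite -[_ * a^-1](mulrVK (x := c)) ?dunitE //.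
by apply: comm_subM => //; apply: comm_subR.
Qed.

(* a and b lie in the same coset of [F^*, F^*], the orbit of 0 being {0} *)
Definition deq a b : bool := `[< exists2 c, commutator_subgroup c & a = b * c >].

Lemma deq_refl : reflexive deq.
Proof. by move=> a; apply/asboolP; exists 1; [exact: comm_sub1 | rewrite mulr1]. Qed.

Lemma deq_imp a b : deq a b -> deq b a.
Proof.
move=> /asboolP[c Hc ->]; apply/asboolP; exists c^-1; first exact: comm_subV.
by rewrite mulrK // dunitE comm_sub_neq0.
Qed.

Lemma deq_sym : symmetric deq.
Proof. by move=> a b; apply/idP/idP; apply: deq_imp. Qed.

Lemma deq_trans : transitive deq.
Proof.
move=> b a c /asboolP[d Hd ->] /asboolP[e He ->]; apply/asboolP.
by exists (e * d); [apply: comm_subM | rewrite mulrA].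
Qed.

Canonical deq_equiv := EquivRel deq deq_refl deq_sym deq_trans.

(* {0} \cup F^*/[F^*, F^*], with its multiplication dmul *)
Definition dab := {eq_quot deq}.
HB.instance Definition _ : EqQuotient _ deq dab := EqQuotient.on dab.
HB.instance Definition _ := Choice.on dab.

(* a (mod [F^*, F^*]) *)
Definition dclass a : dab := \pi_dab a.

Definition dmul (u v : dab) : dab := dclass (generic_quotient.repr u * generic_quotient.repr v).

Lemma dclassP a b :
  dclass a = dclass b <-> exists2 c, commutator_subgroup c & a = b * c.
Proof.
split; first by move=> /eqmodP /asboolP.
by move=> H; apply/eqmodP; apply/asboolP.
Qed.

Lemma dclass_eq0 a : dclass a = dclass 0 <-> a = 0.
Proof. by split=> [/dclassP[c _ ->]|-> //]; rewrite mul0r. Qed.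

Lemma dclass_surj (u : dab) : exists a, u = dclass a.
Proof. by exists (generic_quotient.repr u); rewrite /dclass reprK. Qed.

Lemma dclassM a b : dclass (a * b) = dmul (dclass a) (dclass b).
Proof.
rewrite /dmul; set a' := generic_quotient.repr _; set b' := generic_quotient.repr _.
have /dclassP[c Hc ->] : dclass a = dclass a' by rewrite /dclass reprK.
have /dclassP[d Hd ->] : dclass b = dclass b' by rewrite /dclass reprK.
have [->|b0] := eqVneq b' 0; first by rewrite !(mul0r, mulr0).
apply/dclassP; exists (b'^-1 * c * b' * d).
  apply: comm_subM => //; rewrite -[X in _ * X]invrK.
  by apply: comm_subJ => //; apply: dinv_neq0.
by rewrite !mulrA mulrK ?dunitE.
Qed.

Lemma dclassC a b : dclass (a * b) = dclass (b * a).
Proof.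
have [->|a0] := eqVneq a 0; first by rewrite mul0r mulr0.
have [->|b0] := eqVneq b 0; first by rewrite mul0r mulr0.
apply/dclassP; exists (a^-1 * b^-1 * a^-1^-1 * b^-1^-1).
  by apply: comm_subR; apply: dinv_neq0.
by rewrite !invrK !mulrA mulrK ?mulrV ?mul1r ?dunitE.
Qed.

Lemma dmulA : associative dmul.
Proof.
move=> u v w; have [a ->] := dclass_surj u; have [b ->] := dclass_surj v.
by have [c ->] := dclass_surj w; rewrite -!dclassM mulrA.
Qed.

Lemma dmulC : commutative dmul.
Proof.
move=> u v; have [a ->] := dclass_surj u; have [b ->] := dclass_surj v.
by rewrite -!dclassM dclassC.
Qed.

Lemma dmul1 : left_id (dclass 1) dmul.
Proof. by move=> u; have [a ->] := dclass_surj u; rewrite -dclassM mul1r. Qed.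

HB.instance Definition _ := Monoid.isComLaw.Build dab (dclass 1) dmul
  dmulA dmulC dmul1.

Lemma dmul0 u : dmul (dclass 0) u = dclass 0.
Proof. by have [a ->] := dclass_surj u; rewrite -dclassM mul0r. Qed.

End DivRingTheory.

Section SkewPoly.
Variable F : nzRingType.

Record sderivation (sigma : {rmorphism F -> F}) := SDerivation {
  sder_fun :> {additive F -> F};
  sderM : forall a b : F, sder_fun (a * b) = sigma a * sder_fun b + sder_fun a * b
}.

(* F[x; sigma, delta]; the coefficients are written on the left of powers of x *)
Record skewpoly (sigma : {rmorphism F -> F}) (delta : sderivation sigma) :=
  SkewPoly { skew_poly : {poly F} }.

Arguments SkewPoly {sigma delta}.
Arguments skew_poly {sigma delta}.

Variables (sigma : {rmorphism F -> F}) (delta : sderivation sigma).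
Local Notation R := (skewpoly delta).

HB.instance Definition _ := [isNew for (@skew_poly sigma delta)].
HB.instance Definition _ := [Choice of R by <:].

Definition skew_add (p q : R) : R := SkewPoly (skew_poly p + skew_poly q).
Definition skew_opp (p : R) : R := SkewPoly (- skew_poly p).

Fact skew_addA : associative skew_add.
Proof. by move=> p q r; congr SkewPoly; rewrite /= addrA. Qed.
Fact skew_addC : commutative skew_add.
Proof. by move=> p q; congr SkewPoly; rewrite /= addrC. Qed.
Fact skew_add0 : @left_id R R (SkewPoly 0) skew_add.
Proof. by case=> p; congr SkewPoly; rewrite /= add0r. Qed.
Fact skew_addN : @left_inverse R R R (SkewPoly 0) skew_opp skew_add.
Proof. by move=> p; congr SkewPoly; rewrite /= addNr. Qed.

HB.instance Definition _ := GRing.isZmodule.Build R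
  skew_addA skew_addC skew_add0 skew_addN.

(* left multiplication by x :
   x (\sum_i a_i x^i) = \sum_i (sigma(a_i) x^(i+1) + delta(a_i) x^i) *)
Definition xmul (p : {poly F}) : {poly F} :=
  map_poly sigma p * 'X + map_poly delta p.

(* (\sum_i a_i x^i) q = \sum_i a_i (x^i q) *)
Definition lskew (p q : {poly F}) : {poly F} :=
  \sum_(i < size p) p`_i *: iter i xmul q.

Definition skew_mul (p q : R) : R :=
  SkewPoly (lskew (skew_poly p) (skew_poly q)).

Lemma coef_xmul p i :
  (xmul p)`_i = (if i == 0%N then 0 else sigma p`_i.-1) + delta p`_i.
Proof. by rewrite coefD coefMX !coef_map_id0 ?raddf0. Qed.

Fact xmulB : {morph xmul : p q / p - q}.
Proof.
move=> p q; apply/polyP=> i; rewrite coefB !coef_xmul !coefB.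
by case: eqP => _; rewrite !raddfB ?subr0 ?add0r // opprD addrACA.
Qed.
HB.instance Definition _ := GRing.isZmodMorphism.Build _ _ xmul xmulB.

Lemma xmulZ a p : xmul (a *: p) = sigma a *: xmul p + delta a *: p.
Proof.
apply/polyP=> i; rewrite coef_xmul [RHS]coefD !coefZ coef_xmul sderM.
by case: eqP => _; rewrite ?rmorphM ?add0r // mulrDr addrA.
Qed.

Lemma iter_xmulB n : {morph iter n xmul : p q / p - q}.
Proof. by elim: n => // n IH p q; rewrite /= IH raddfB. Qed.

HB.instance Definition _ n :=
  GRing.isZmodMorphism.Build _ _ (iter n xmul) (@iter_xmulB n).

Lemma lskewE n (p q : {poly F}) : (size p <= n)%N ->
  lskew p q = \sum_(i < n) p`_i *: iter i xmul q.
Proof.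
move=> le_pn; rewrite /lskew (big_ord_widen _ (fun i => p`_i *: iter i xmul q) le_pn).
rewrite big_mkcond; apply: eq_bigr => i _; case: ltnP => // le_pi.
by rewrite nth_default ?scale0r.
Qed.

Lemma lskewDl p1 p2 q : lskew (p1 + p2) q = lskew p1 q + lskew p2 q.
Proof.
pose n := maxn (size p1) (size p2).
rewrite !(@lskewE n) ?leq_maxl ?leq_maxr ?size_polyD // -big_split /=.
by apply: eq_bigr => i _; rewrite coefD scalerDl.
Qed.

Lemma lskewDr p q1 q2 : lskew p (q1 + q2) = lskew p q1 + lskew p q2.
Proof.
by rewrite -big_split; apply: eq_bigr => i _; rewrite raddfD scalerDr.
Qed.

Lemma lskewZl a p q : lskew (a *: p) q = a *: lskew p q.
Proof.
rewrite !(@lskewE (size p)) ?size_scale_leq // scaler_sumr.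
by apply: eq_bigr => i _; rewrite coefZ scalerA.
Qed.

Lemma lskew_suml (I : Type) (r : seq I) (P : pred I) (E : I -> {poly F}) q :
  lskew (\sum_(i <- r | P i) E i) q = \sum_(i <- r | P i) lskew (E i) q.
Proof.
apply: (big_morph (lskew^~ q)) => [p1 p2|]; first exact: lskewDl.
by rewrite /lskew size_poly0 big_ord0.
Qed.

Lemma lskew_sumr (I : Type) (r : seq I) (P : pred I) (E : I -> {poly F}) p :
  lskew p (\sum_(i <- r | P i) E i) = \sum_(i <- r | P i) lskew p (E i).
Proof.
apply: (big_morph (lskew p)) => [q1 q2|]; first exact: lskewDr.
by rewrite /lskew big1 // => i _; rewrite raddf0 scaler0.
Qed.

Lemma lskewX p q : lskew (xmul p) q = xmul (lskew p q).
Proof.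
rewrite (@lskewE (size p).+1); last first.
  apply: (leq_trans (size_polyD _ _)); rewrite geq_max.
  rewrite (leq_trans (size_polyMleq _ _)) ?size_polyX ?addn2 ?ltnS ?size_poly //=.
  by rewrite (leq_trans (size_poly _ _)).
under eq_bigr do rewrite coef_xmul scalerDl.
rewrite big_split /= big_ord_recl /= scale0r add0r big_ord_recr /=.
rewrite [p`_(size p)]nth_default // raddf0 scale0r addr0 -big_split /=.
rewrite /lskew raddf_sum; apply: eq_bigr => i _.
by rewrite /= xmulZ.
Qed.

Lemma lskew_iterX i p q : lskew (iter i xmul p) q = iter i xmul (lskew p q).
Proof. by elim: i => //= i IH; rewrite lskewX IH. Qed.

Fact skew_mulA : associative skew_mul.
Proof.
move=> [p] [q] [r]; congr SkewPoly => /=.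
rewrite [lskew p q]/lskew lskew_suml; apply: eq_bigr => i _.
by rewrite lskewZl lskew_iterX.
Qed.

Lemma xmul_Xn i : xmul 'X^i = 'X^(i.+1).
Proof.
apply/polyP=> j; rewrite coef_xmul !coefXn.
have delta1 : delta 1 = 0.
  apply: (@addrI _ (delta 1)); rewrite addr0.
  by have := sderM delta 1 1; rewrite rmorph1 !mul1r mulr1 => <-.
have -> : delta (j == i)%:R = 0 by case: (j == i); rewrite ?raddf0.
by case: j => [|j]; rewrite /= ?addr0 // rmorph_nat.
Qed.

Lemma iter_xmul1 i : iter i xmul 1 = 'X^i.
Proof. by elim: i => [|i IH]; rewrite ?expr0 //= IH xmul_Xn. Qed.

Fact skew_mul1 : @left_id R R (SkewPoly 1) skew_mul.
Proof.
case=> p; congr SkewPoly; rewrite /= (@lskewE 1) ?size_poly1 //.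
by rewrite big_ord_recl big_ord0 coef1 scale1r addr0.
Qed.

Fact skew_mul1r : @right_id R R (SkewPoly 1) skew_mul.
Proof.
case=> p; congr SkewPoly; rewrite /= /lskew.
under eq_bigr do rewrite iter_xmul1.
by rewrite -[RHS]coefK poly_def.
Qed.

Fact skew_mulDl : left_distributive skew_mul +%R.
Proof. by move=> [p] [q] [r]; congr SkewPoly; apply: lskewDl. Qed.

Fact skew_mulDr : right_distributive skew_mul +%R.
Proof. by move=> [p] [q] [r]; congr SkewPoly; apply: lskewDr. Qed.

Fact skew_oner_neq0 : SkewPoly 1 != 0 :> R.
Proof. by apply/eqP => -[] /eqP; rewrite oner_eq0. Qed.

HB.instance Definition _ := GRing.Zmodule_isNzRing.Build R
  skew_mulA skew_mul1 skew_mul1r skew_mulDl skew_mulDr skew_oner_neq0.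

Implicit Types f g : R.

Definition skewC (a : F) : R := SkewPoly a%:P.
Definition skewX : R := SkewPoly 'X.

Definition skew_coef f (i : nat) : F := (skew_poly f)`_i.

(* for f != 0 *)
Definition skew_deg f : nat := (size (skew_poly f)).-1.

Lemma skew_polyD f g : skew_poly (f + g) = skew_poly f + skew_poly g.
Proof. by []. Qed.

Lemma skewC_mul a f : skew_poly (skewC a * f) = a *: skew_poly f.
Proof.
rewrite /= (@lskewE 1) ?size_polyC_leq1 //.
by rewrite big_ord_recl big_ord0 coefC addr0.
Qed.

Lemma skewX_mul f : skew_poly (skewX * f) = xmul (skew_poly f).
Proof.
rewrite /= (@lskewE 2) ?size_polyX //.
by rewrite !big_ord_recl big_ord0 !coefX /= scale0r add0r scale1r addr0.
Qed.

Lemma skewX_expr_mul i f : skew_poly (skewX ^+ i * f) = iter i xmul (skew_poly f).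
Proof.
elim: i => [|i IH]; first by rewrite expr0 mul1r.
by rewrite exprS -mulrA skewX_mul IH.
Qed.

Lemma skewXC a : skewX * skewC a = skewC (sigma a) * skewX + skewC (delta a).
Proof.
apply: val_inj; rewrite -[val]/(@skew_poly sigma delta) skewX_mul skew_polyD skewC_mul.
apply/polyP=> i; rewrite coef_xmul coefD coefZ coefX /= !coefC.
by case: i => [|[|i]]; rewrite /= ?raddf0 ?mulr0 ?mulr1 ?addr0.
Qed.

Lemma skewCM a b : skewC (a * b) = skewC a * skewC b.
Proof. by apply: val_inj; rewrite -[val]/(@skew_poly sigma delta) skewC_mul /= -mul_polyC polyCM. Qed.

Lemma skewCD a b : skewC (a + b) = skewC a + skewC b.
Proof. by apply: val_inj; rewrite /= polyCD. Qed.

Lemma skewE f : f = \sum_(i < size (skew_poly f)) skewC (skew_coef f i) * skewX ^+ i.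
Proof.
apply: val_inj; rewrite -[val]/(@skew_poly sigma delta).
rewrite (big_morph (@skew_poly sigma delta) (id1 := 0) (op1 := +%R)) //.
rewrite -{1}[skew_poly f]coefK poly_def; apply: eq_bigr => i _.
by rewrite skewC_mul -[skewX ^+ i]mulr1 skewX_expr_mul iter_xmul1.
Qed.

Fixpoint skewN (i : nat) (a : F) : F :=
  if i is j.+1 then sigma (skewN j a) * a + delta (skewN j a) else 1.

Lemma skew_rdiv f a : {qr : R * F | f = qr.1 * (skewX - skewC a) + skewC qr.2}.
Proof.
have divX i : {q : R | skewX ^+ i = q * (skewX - skewC a) + skewC (skewN i a)}.
  elim: i => [|i [q Dq]]; first by exists 0; rewrite mul0r add0r.
  exists (skewX * q + skewC (sigma (skewN i a))).
  rewrite exprS Dq mulrDr skewXC mulrDl mulrA [skewC _ * (_ - _)]mulrBr -skewCM skewCD.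
  by rewrite -!addrA; congr (_ + (_ + _)); rewrite addrA addNr add0r.
exists (\sum_(i < size (skew_poly f)) skewC (skew_coef f i) * sval (divX i),
        \sum_(i < size (skew_poly f)) skew_coef f i * skewN i a).
rewrite {1}[f]skewE /= mulr_suml.
rewrite (big_morph skewC skewCD (erefl : skewC 0 = 0)) -big_split /=.
apply: eq_bigr => i _; rewrite skewCM -mulrA -mulrDr; congr (_ * _).
by case: (divX i).
Qed.

(* f(a), the remainder of the right division of f by x - a *)
Definition skew_eval f a : F := (sval (skew_rdiv f a)).2.

Lemma skew_evalP f a : exists q, f = q * (skewX - skewC a) + skewC (skew_eval f a).
Proof.
by exists (sval (skew_rdiv f a)).1; rewrite /skew_eval; case: (skew_rdiv f a).
Qed.

Lemma coef_mulX_subC f a i : skew_coef (f * (skewX - skewC a)) i.+1 =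
  skew_coef f i - skew_coef (f * skewC a) i.+1.
Proof.
rewrite mulrBr /skew_coef /= -[_ - _]/(_ + _) coefD coefN; congr (_ - _).
rewrite {1}/lskew; under eq_bigr do rewrite -[X in iter _ _ X]expr1 -(iter_xmul1 1) -iterD addn1 iter_xmul1.
under eq_bigr do rewrite exprSr scalerAl.
by rewrite -mulr_suml -poly_def coefK coefMX.
Qed.

Lemma size_mulC f a :
  (size (skew_poly (f * skewC a)%R) <= size (skew_poly f))%N.
Proof.
have szX i : (size (iter i xmul a%:P)%R <= i.+1)%N.
  elim: i => [|i IH]; first exact: size_polyC_leq1.
  apply/leq_sizeP => j lt_ij; rewrite /= coef_xmul.
  case: j lt_ij => // j lt_ij /=.
  by rewrite !(leq_sizeP _ _ IH) ?raddf0 ?addr0 // ltnW.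
rewrite /= /lskew (leq_trans (size_sum _ _ _)) //; apply/bigmax_leqP => i _.
by rewrite (leq_trans (size_scale_leq _ _)) // (leq_trans (szX i)).
Qed.

Lemma skew_eval_uniq f a q r :
  f = q * (skewX - skewC a) + skewC r -> r = skew_eval f a.
Proof.
have [q' Dq'] := skew_evalP f a; move: Dq'; set r' := skew_eval f a => -> E.
have {}E : (q' - q) * (skewX - skewC a) = skewC r - skewC r'.
  rewrite mulrBl; apply/eqP.
  by rewrite subr_eq addrAC eq_sym subr_eq E addrC.
have Ddelta : q' - q = 0.
  apply/eqP/negPn/negP => nz; set p := q' - q in E nz.
  have szp : (0 < size (skew_poly p))%N.
    by rewrite lt0n size_poly_eq0; apply: contraNneq nz => Ep; apply/eqP/val_inj.
  have := coef_mulX_subC p a (size (skew_poly p)).-1.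
  rewrite E prednK // [skew_coef (p * _) _](leq_sizeP _ _ (size_mulC p a)) // subr0.
  rewrite {1}/skew_coef /= coefD coefN !coefC -(prednK szp) /= subrr => /esym/eqP.
  rewrite /skew_coef -lead_coefE lead_coef_eq0 -size_poly_eq0 => /eqP E0.
  by rewrite E0 in szp.
move: E; rewrite Ddelta mul0r => /esym/eqP; rewrite subr_eq0 => /eqP[/polyP/(_ 0%N)].
by rewrite !coefC.
Qed.

(* with m = deg f and n = deg g, row i < n is x^i f and row n + i, i < m, is
   x^i g *)
Definition skew_sylvester f g : 'M[F]_(skew_deg f + skew_deg g) :=
  \matrix_(i, j)
    if (i < skew_deg g)%N then skew_coef (skewX ^+ i * f) j
    else skew_coef (skewX ^+ (i - skew_deg g) * g) j.

End SkewPoly.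

Arguments skewX {F sigma delta}.
Arguments skewC {F sigma delta} a.

Section DieudonneDet.
Variable F : divRingType.

(* Schur complement of the entry (i, 0) of A *)
Definition schur p q (A : 'M[F]_(p.+1, q.+1)) (i : 'I_p.+1) : 'M[F]_(p, q) :=
  \matrix_(k, l) (A (lift i k) (lift ord0 l) -
                  A (lift i k) ord0 / A i ord0 * A i (lift ord0 l)).

(* The Dieudonne determinant, by Gaussian elimination with left row operations.
   It is independent of the pivots (ddet_expand) and satisfies the properties
   that characterize it: ddet1, ddet_row_scale, ddet_row_add and ddet_eq0. *)
Fixpoint ddet n : 'M[F]_n -> dab F :=
  if n isn't p.+1 then fun=> dclass 1
  else fun A => if [pick i | A i ord0 != 0] is Some i
                then dmul (dclass ((-1) ^+ i * A i ord0)) (ddet (schur A i))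
                else dclass 0.

Definition row_scale n (i : 'I_n) (c : F) (A : 'M[F]_n) : 'M[F]_n :=
  \matrix_(k, l) (if k == i then c * A k l else A k l).

(* add c times row k to row j *)
Definition row_add n (j k : 'I_n) (c : F) (A : 'M[F]_n) : 'M[F]_n :=
  \matrix_(u, v) (if u == j then A u v + c * A k v else A u v).

Definition pivot_indep n := forall (A : 'M[F]_n.+1) i, A i ord0 != 0 ->
  ddet A = dmul (dclass ((-1) ^+ i * A i ord0)) (ddet (schur A i)).

Lemma ddet_col0 n (A : 'M[F]_n.+1) : (forall i, A i ord0 = 0) -> ddet A = dclass 0.
Proof. by move=> A0 /=; case: pickP => // i; rewrite A0 eqxx. Qed.

Lemma ddet_row_scale_aux n : pivot_indep n ->
  (forall j c (A : 'M[F]_n), c != 0 -> ddet (row_scale j c A) = dmul (dclass c) (ddet A)) ->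
  forall j c (A : 'M[F]_n.+1), c != 0 ->
    ddet (row_scale j c A) = dmul (dclass c) (ddet A).
Proof.
move=> IHp IHs j c A c0.
case: (pickP (fun i => A i ord0 != 0)) => [i Ai|A0]; last first.
  have {}A0 i : A i ord0 = 0 by apply/eqP; have := A0 i; case: eqP.
  rewrite !ddet_col0 //; first by rewrite dmulC dmul0.
  by move=> i; rewrite mxE A0 mulr0 if_same.
rewrite [in RHS](IHp _ _ Ai).
have Bi : row_scale j c A i ord0 != 0.
  by rewrite mxE; case: ifP => // _; apply: dmulf_neq0.
rewrite (IHp _ _ Bi) mxE.
have [eij|nij] := eqVneq i j.
  rewrite (_ : schur _ i = schur A i); last first.
    apply/matrixP=> k l; rewrite !mxE -eij eqxx.
    rewrite ![lift i k == i]eq_sym !(negPf (neq_lift _ _)).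
    by rewrite invrM ?dunitE // !mulrA mulrVK ?dunitE.
  rewrite mulrA -(commr_sign c i) -mulrA dclassM -dmulA.
  by [].
have /unlift_some[k Dk _] := nij.
rewrite (_ : schur _ i = row_scale k c (schur A i)) ?IHs //.
  by rewrite dmulA [dmul (dclass _) (dclass c)]dmulC -dmulA.
apply/matrixP=> u l; rewrite !mxE (negPf nij) Dk (inj_eq lift_inj).
by case: eqP => // ->; rewrite mulrBr !mulrA.
Qed.

Lemma ddet_row_add_aux n : pivot_indep n ->
  (forall j k c (A : 'M[F]_n), j != k -> ddet (row_add j k c A) = ddet A) ->
  forall j k c (A : 'M[F]_n.+1), j != k -> ddet (row_add j k c A) = ddet A.
Proof.
move=> IHp IHa j k c A njk.
case: (pickP (fun i => (i != j) && (A i ord0 != 0))) => [i /andP[nij Ai]|A0].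
  have Bi : row_add j k c A i ord0 = A i ord0 by rewrite mxE (negPf nij).
  rewrite (IHp _ i) Bi // (IHp A i) //; congr dmul.
  have /unlift_some[j' Dj _] := nij.
  have [Dk|nik] := eqVneq i k.
    congr ddet; apply/matrixP=> u l; rewrite !mxE (negPf nij) -Dk.
    case: eqP => // _; rewrite !mulrDl [c * A i ord0 * _]mulrK ?dunitE //.
    by rewrite opprD addrACA subrr addr0.
  have /unlift_some[k' Dk _] := nik.
  rewrite -(IHa j' k' c (schur A i)); last by rewrite -(inj_eq (@lift_inj _ i)) -Dj -Dk.
  congr ddet; apply/matrixP=> u l; rewrite !mxE (negPf nij) Dj Dk (inj_eq lift_inj).
  case: eqP => // _; rewrite !mulrDl mulrBr !mulrA opprD addrACA //.
have {}A0 i : i != j -> A i ord0 = 0.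
  by move=> nij; apply/eqP; have := A0 i; rewrite nij; case: eqP.
have Bj : row_add j k c A j ord0 = A j ord0.
  by rewrite mxE eqxx (A0 k) 1?eq_sym // mulr0 addr0.
have [Aj|Aj] := eqVneq (A j ord0) 0.
  have {}A0 i : A i ord0 = 0 by have [->|/A0] := eqVneq i j.
  by rewrite !ddet_col0 // => i; rewrite mxE !A0 mulr0 addr0 if_same.
rewrite (IHp _ j) Bj // (IHp A j) //; congr (dmul _ (ddet _)).
apply/matrixP=> u l; rewrite !mxE ![lift j u == j]eq_sym !(negPf (neq_lift _ _)).
by rewrite (A0 (lift j u)) 1?eq_sym ?neq_lift // !mul0r.
Qed.

Definition row_inv n :=
  (forall j c (A : 'M[F]_n), c != 0 -> ddet (row_scale j c A) = dmul (dclass c) (ddet A)) /\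
  (forall j k c (A : 'M[F]_n), j != k -> ddet (row_add j k c A) = ddet A).

Lemma row_inv_tperm n (A : 'M[F]_n) j k : row_inv n -> j != k ->
  ddet (row_perm (tperm j k) A) = dmul (dclass (-1)) (ddet A).
Proof.
move=> [Hs Ha] njk; have nkj : k != j by rewrite eq_sym.
rewrite -[in RHS](Ha j k 1) // -[in RHS](Ha k j (-1)) // -[in RHS](Ha j k 1) //.
rewrite -(Hs k (-1)) ?oppr_eq0 ?oner_eq0 //.
congr ddet; apply/matrixP=> u l; rewrite !mxE !(eqxx, negPf njk, negPf nkj).
case: tpermP => [->|->|/eqP/negPf-> /eqP/negPf-> //].
  by rewrite eqxx (negPf njk) !mulN1r !mul1r addrC subrK.
by rewrite eqxx (negPf nkj) !mulN1r !mul1r opprB addrK.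
Qed.

Lemma row_inv_perm n (A : 'M[F]_n) (s : 'S_n) : row_inv n ->
  ddet (row_perm s A) = dmul (dclass ((-1) ^+ s)) (ddet A).
Proof.
move=> Hn; have [ts -> /= dts] := prod_tpermP s.
elim: ts dts => [|t ts IH] /=.
  by rewrite big_nil odd_perm1 expr0 dmul1 row_perm1.
case/andP=> nt /IH {}IH; rewrite big_cons row_permM row_inv_tperm // IH.
by rewrite odd_permM odd_tperm nt signr_addb dclassM -dmulA.
Qed.

Lemma row_inv_adds n (A : 'M[F]_n) r (c : 'I_n -> F) : row_inv n -> c r = 0 ->
  ddet (\matrix_(u, v) (A u v + c u * A r v)) = ddet A.
Proof.
move=> [_ Ha] cr.
pose B (t : seq 'I_n) := \matrix_(u, v) (A u v + (if u \in t then c u else 0) * A r v).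
suff HB t : uniq t -> ddet (B t) = ddet A.
  rewrite -(HB _ (enum_uniq 'I_n)); congr ddet.
  by apply/matrixP=> u v; rewrite !mxE mem_enum.
elim: t => [_|j t IH /= /andP[jt /IH <-]].
  by congr ddet; apply/matrixP=> u v; rewrite !mxE mul0r addr0.
have [jr|jr] := eqVneq j r.
  congr ddet; apply/matrixP=> u v; rewrite !mxE inE.
  by have [->|//] := eqVneq u j; rewrite jr cr if_same.
rewrite -(Ha j r (c j) (B t) jr); congr ddet; apply/matrixP=> u v; rewrite !mxE inE.
have [->|//] := eqVneq u j; rewrite (negPf jt) mul0r addr0.
by rewrite cr if_same mul0r addr0.
Qed.

Lemma row_inv_pivot n : row_inv n -> pivot_indep n.
Proof.
move=> Hn A i' Ai' /=; case: pickP => [i Ai|/(_ i')]; last by rewrite Ai'.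
have [->//|ni] := eqVneq i i'.
pose t k := odflt k (unlift i' (tperm i i' (lift i k))).
have tE k : lift i' (t k) = tperm i i' (lift i k).
  rewrite /t; have: i' != tperm i i' (lift i k).
    by rewrite -{1}(tpermL i i') (inj_eq perm_inj) neq_lift.
  by case/unlift_some => ? ? ->.
have t_inj : injective t.
  by move=> k l /(congr1 (lift i')); rewrite !tE => /perm_inj/lift_inj.
pose s := perm t_inj.
have odd_s : s = ~~ (odd i (+) odd i') :> bool.
  have : lift_perm i i' s = tperm i i'.
    apply/permP=> u; case: (unliftP i u) => [k ->|->].
      by rewrite lift_perm_lift permE tE.
    by rewrite lift_perm_id tpermL.
  move/(congr1 (@odd_perm _)); rewrite odd_lift_perm odd_tperm ni.
  by case: (odd i) (odd i') (s : bool) => [] [] [].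
have /unlift_some[k0 Dk0 _] := ni.
have := row_inv_perm (schur A i') s Hn.
pose c k := if k == k0 then 0 else - (A (lift i k) ord0 / A i' ord0).
rewrite (_ : row_perm s _ = row_scale k0 (- (A i ord0 / A i' ord0))
   (\matrix_(u, v) (schur A i u v + c u * schur A i k0 v))); last first.
  apply/matrixP=> u l; rewrite !mxE permE tE /c -Dk0.
  have [->|nu] := eqVneq u k0.
    rewrite -Dk0 tpermR mul0r addr0 mulNr mulrBr !mulrA mulrVK ?dunitE //.
    by rewrite mulrV ?dunitE // mul1r opprB.
  rewrite tpermD; last 2 first.
  - by rewrite neq_lift.
  - by rewrite Dk0 (inj_eq lift_inj) eq_sym.
  rewrite mulNr mulrBr !mulrA mulrVK ?dunitE // opprB addrA addrAC.
  by rewrite [_ + _ - _]addrAC subrK addrC.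
have nz : - (A i ord0 / A i' ord0) != 0.
  by rewrite oppr_eq0; apply: dmulf_neq0 => //; apply: dinv_neq0.
rewrite (proj1 Hn) // (row_inv_adds _ Hn) ?/c ?eqxx // => E.
have {}E : ddet (schur A i') =
    dmul (dclass ((-1) ^+ s * - (A i ord0 / A i' ord0))) (ddet (schur A i)).
  by rewrite dclassM -dmulA E dmulA -dclassM -signr_addb addbb dmul1.
rewrite E dmulA -dclassM; congr dmul.
rewrite [in RHS]dclassC -(commr_sign (A i' ord0) i').
rewrite mulrN mulNr -!mulrA mulKr ?dunitE // commr_sign mulrA.
rewrite -mulNr -[(-1) ^+ i']signr_odd -signr_addb -signrN odd_s -signr_odd.
by case: (odd i) (odd i') => [] [].
Qed.

Lemma row_invT n : row_inv n.
Proof.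
elim: n => [|n IH]; first by split; case=> [[]].
have IHp := row_inv_pivot IH; case: IH => IHs IHa.
by split; [apply: ddet_row_scale_aux | apply: ddet_row_add_aux].
Qed.

Lemma ddet_expand n (A : 'M[F]_n.+1) i : A i ord0 != 0 ->
  ddet A = dmul (dclass ((-1) ^+ i * A i ord0)) (ddet (schur A i)).
Proof. exact/row_inv_pivot/row_invT. Qed.

Lemma ddet_row_scale n j c (A : 'M[F]_n) : c != 0 ->
  ddet (row_scale j c A) = dmul (dclass c) (ddet A).
Proof. exact: (proj1 (row_invT n)). Qed.

Lemma ddet_row_add n j k c (A : 'M[F]_n) : j != k -> ddet (row_add j k c A) = ddet A.
Proof. exact: (proj2 (row_invT n)). Qed.

Lemma ddet_row_perm n (A : 'M[F]_n) (s : 'S_n) :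
  ddet (row_perm s A) = dmul (dclass ((-1) ^+ s)) (ddet A).
Proof. exact/row_inv_perm/row_invT. Qed.

Lemma ddet1 n : ddet (1%:M : 'M[F]_n) = dclass 1.
Proof.
elim: n => // n IH; rewrite (@ddet_expand _ _ ord0) !mxE eqxx ?oner_neq0 //.
rewrite expr0 mulr1 dmul1 -[RHS]IH; congr ddet; apply/matrixP=> k l.
by rewrite !mxE !(inj_eq lift_inj) [lift _ _ == _]eq_sym (negPf (neq_lift _ _)) !mul0r subr0.
Qed.

Definition row_dep p q (A : 'M[F]_(p, q)) := exists2 u : 'rV_p, u != 0 & u *m A = 0.

Lemma row_dep_schur p q (A : 'M[F]_(p.+1, q.+1)) i : A i ord0 != 0 ->
  row_dep A <-> row_dep (schur A i).
Proof.
move=> Ai; split=> -[u u0 uA].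
  have Eu l : \sum_k u 0 (lift i k) * A (lift i k) l = - (u 0 i * A i l).
    have /rowP/(_ l) := uA; rewrite !mxE (bigD1_ord i) //= => /eqP.
    by rewrite addrC addr_eq0 => /eqP.
  exists (\row_k u 0 (lift i k)).
    apply: contraNneq u0 => /rowP u0; have {}u0 k : u 0 (lift i k) = 0.
      by have := u0 k; rewrite !mxE.
    have ui : u 0 i = 0.
      have := Eu ord0; rewrite big1 => [/esym/eqP|k _]; last by rewrite u0 mul0r.
      rewrite oppr_eq0; apply: contraTeq => nz; exact: dmulf_neq0.
    by apply/eqP/rowP=> k; rewrite mxE; case: (unliftP i k) => [k'|] ->.
  apply/rowP=> l; rewrite !mxE.
  under eq_bigr do rewrite !mxE mulrBr !mulrA.
  by rewrite sumrB -!mulr_suml !Eu mulNr mulrK ?dunitE // mulNr subrr.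
pose v := - \sum_k u 0 k * A (lift i k) ord0 / A i ord0.
exists (\row_k if unlift i k is Some k' then u 0 k' else v).
  apply: contraNneq u0 => /rowP u0; apply/eqP/rowP=> k.
  by have := u0 (lift i k); rewrite !mxE liftK.
apply/rowP=> l; rewrite !mxE (bigD1_ord i) //= mxE unlift_none.
under eq_bigr do rewrite mxE liftK.
rewrite {}/v mulNr mulr_suml; apply/eqP; rewrite addrC subr_eq0; apply/eqP.
case: (unliftP ord0 l) => [l'|] ->; last first.
  by apply: eq_bigr => k _; rewrite mulrVK ?dunitE.
apply/eqP; rewrite -subr_eq0 -sumrB; apply/eqP.
have /rowP/(_ l') := uA; rewrite !mxE => E; rewrite -[RHS]E.
by apply: eq_bigr => k _; rewrite !mxE mulrBr !mulrA.
Qed.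

Lemma row_dep_tall p q (A : 'M[F]_(p, q)) : (q < p)%N -> row_dep A.
Proof.
elim: q p A => [|q IH] [|p] A // lt_qp.
  exists (const_mx 1); last by apply/rowP; case.
  by apply/eqP => /rowP/(_ ord0)/eqP; rewrite !mxE oner_eq0.
case: (pickP (fun i => A i ord0 != 0)) => [i Ai|A0].
  by apply/(row_dep_schur Ai)/IH.
have [u u0 uA] := IH _ (col' ord0 A) (ltnW lt_qp); exists u => //.
apply/rowP=> l; case: (unliftP ord0 l) => [l'|] ->.
  have /rowP/(_ l') := uA; rewrite !mxE => E; rewrite -[RHS]E.
  by apply: eq_bigr => k _; rewrite !mxE.
rewrite !mxE big1 // => k _; have /negbFE/eqP -> := A0 k.
by rewrite mulr0.
Qed.

Lemma ddet_eq0 n (A : 'M[F]_n) : ddet A = dclass 0 <-> row_dep A.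
Proof.
elim: n A => [|n IH] A.
  split=> [/dclass_eq0/eqP|[u u0 _]]; first by rewrite oner_eq0.
  by case/eqP: u0; apply/rowP; case.
case: (pickP (fun i => A i ord0 != 0)) => [i Ai|A0]; last first.
  have {}A0 i : A i ord0 = 0 by apply/eqP; have /negbFE := A0 i.
  rewrite ddet_col0 //; split=> // _.
  have [u u0 uA] := row_dep_tall (col' ord0 A) (ltnSn n); exists u => //.
  apply/rowP=> l; case: (unliftP ord0 l) => [l'|] ->.
    have /rowP/(_ l') := uA; rewrite !mxE => E; rewrite -[RHS]E.
    by apply: eq_bigr => k _; rewrite !mxE.
  by rewrite !mxE big1 // => k _; rewrite A0 mulr0.
apply: iff_trans (iff_sym (row_dep_schur Ai)); apply: iff_trans (IH _).
rewrite (ddet_expand Ai).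
have [a ->] := dclass_surj (ddet (schur A i)); rewrite -dclassM !dclass_eq0.
split=> [/eqP|->]; last by rewrite mulr0.
apply: contraTeq => a0; do 2?apply: dmulf_neq0 => //.
by rewrite -dunitE rpredX ?rpredN ?rpred1.
Qed.

End DieudonneDet.

Definition skew_resultant (F : divRingType) (sigma : {rmorphism F -> F})
    (delta : sderivation sigma) (f g : skewpoly delta) : dab F :=
  ddet (skew_sylvester f g).

(* Main.v *)
Require Import Defs.
From HB Require Import structures.
From mathcomp Require Import all_boot all_order all_algebra.
From mathcomp Require Import fingroup perm zify.

Set Implicit Arguments.
Unset Strict Implicit.
Unset Printing Implicit Defensive.

Import GRing.Theory.
Local Open Scope ring_scope.

(** The Dieudonné determinant is governed by row operations. Exchanging f and g
    rotates the rows of the Sylvester matrix cyclically by n places, a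
    permutation of sign (-1)^(mn); a left factor of f that passes through the
    powers of x scales the first n rows. When g is a constant the matrix is
    triangular. When g = x - a, right division f = q (x - a) + f(a) shows that
    subtracting the combination q (x - a) of the last m rows from the first row
    leaves a triangular matrix with diagonal f(a), 1, ..., 1; hence the resultant
    is the class of f(a). *)

(** * Row operations, triangular matrices and cyclic rotations *)

Section DieudonneDet.
Variable F : divRingType.
Implicit Types (a : F) (n : nat).

Lemma iter_neq0 (sigma : {rmorphism F -> F}) a i :
  a != 0 -> iter i sigma a != 0.
Proof. by move=> a0; elim: i => // i; rewrite -!dunitE => /rmorph_unit ->. Qed.

Lemma ddet_row_scales n (d : 'I_n -> F) (A : 'M[F]_n) : (forall i, d i != 0) ->
  ddet (\matrix_(i, j) (d i * A i j)) = dmul (dclass (\prod_i d i)) (ddet A).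
Proof.
(* [B t] scales only the rows listed in [t]; since [t] has no repetition, no row is scaled twice. *)
move=> d0; pose B (t : seq 'I_n) :=
  \matrix_(i, j) ((if i \in t then d i else 1) * A i j).
suff HB t : uniq t -> ddet (B t) = dmul (dclass (\prod_(i <- t) d i)) (ddet A).
  rewrite -HB ?index_enum_uniq //; congr ddet.
  by apply/matrixP=> i j; rewrite !mxE mem_index_enum.
elim: t => [_|k t IH /= /andP[kt /IH {}IH]].
  rewrite big_nil dmul1; congr ddet.
  by apply/matrixP=> i j; rewrite mxE mul1r.
rewrite big_cons dclassM -dmulA -IH -(ddet_row_scale k) //; congr ddet.
apply/matrixP=> i j; rewrite !mxE inE.
by have [->|//] := eqVneq i k; rewrite (negPf kt) mul1r.
Qed.

Lemma ddet_row_comb n r (c : 'I_n -> F) (A : 'M[F]_n) : c r = 0 ->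
  ddet (\matrix_(i, j) (if i == r then A r j + \sum_k c k * A k j else A i j))
  = ddet A.
Proof.
move=> cr; pose B (t : seq 'I_n) := \matrix_(i, j)
  (if i == r then A r j + \sum_(k <- t) c k * A k j else A i j).
suff HB t : ddet (B t) = ddet A.
  by rewrite -(HB (index_enum 'I_n)).
elim: t => [|k t <-].
  by congr ddet; apply/matrixP=> i j; rewrite mxE big_nil addr0; case: eqP => [->|].
have [->|rk] := eqVneq k r.
  by congr ddet; apply/matrixP=> i j; rewrite !mxE big_cons cr mul0r add0r.
rewrite -(ddet_row_add (c k) (B t) (j := r) (k := k)); last by rewrite eq_sym.
congr ddet; apply/matrixP=> i j; rewrite !mxE big_cons (negPf rk).
by case: eqP => // _; rewrite addrAC addrA.
Qed.

(** Induction on the size: with a nonzero corner entry, the Schur complement merely deletes the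
    first row and column, because the rest of the first row vanishes. *)
Lemma ddet_lower n (A : 'M[F]_n) : (forall i j : 'I_n, (i < j)%N -> A i j = 0) ->
  ddet A = dclass (\prod_i A i i).
Proof.
elim: n A => [|n IH] A A0; first by rewrite big_ord0.
have A0r (l : 'I_n) : A ord0 (lift ord0 l) = 0 by apply: A0.
have [a0|a0] := eqVneq (A ord0 ord0) 0.
  (* A zero corner makes the whole first row zero, so the first unit vector is a left dependency. *)
  rewrite big_ord_recl a0 mul0r; apply/ddet_eq0; exists (delta_mx 0 ord0).
    by apply/eqP=> /rowP/(_ ord0)/eqP; rewrite !mxE !eqxx oner_eq0.
  rewrite -rowE; apply/rowP=> j; rewrite !mxE.
  by case: (unliftP ord0 j) => [k|] ->.
have sE : schur A ord0 = \matrix_(i, j) A (lift ord0 i) (lift ord0 j).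
  by apply/matrixP=> i j; rewrite !mxE A0r mulr0 subr0.
rewrite (ddet_expand a0) expr0 mul1r sE IH; last first.
  by move=> i j ij; rewrite mxE A0.
rewrite big_ord_recl dclassM; congr (dmul _ (dclass _)).
by apply: eq_bigr => i _; rewrite mxE.
Qed.

(** The cycle [i] to [i + 1] modulo [n.+1]; as a [lift_perm], its sign can be read off from the two
    distinguished indices. *)
Definition rot_perm n : 'S_n.+1 := lift_perm ord_max ord0 1.

Lemma rot_permE n (i : 'I_n.+1) : rot_perm n i = (i.+1 %% n.+1)%N :> nat.
Proof.
rewrite /rot_perm; case: (unliftP ord_max i) => [k|] ->.
  by rewrite lift_perm_lift perm1 lift0 lift_max modn_small // ltnS.
by rewrite lift_perm_id /= modnn.
Qed.

Lemma rot_perm_expE n k (i : 'I_n.+1) :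
  (rot_perm n ^+ k)%g i = ((i + k) %% n.+1)%N :> nat.
Proof.
elim: k => [|k IH]; first by rewrite expg0 perm1 addn0 modn_small.
by rewrite expgSr permM rot_permE IH -addn1 modnDml addn1 addnS.
Qed.

Lemma odd_rot_perm_exp n k : (rot_perm n ^+ k)%g = odd (k * n) :> bool.
Proof.
elim: k => [|k IH]; first by rewrite expg0 odd_perm1.
rewrite expgS odd_permM IH mulSn oddD; congr (_ (+) _).
by rewrite odd_lift_perm odd_perm1 /= !addbF.
Qed.

End DieudonneDet.

(** * Rows of the Sylvester matrix and the resultant *)

Section SkewResultant.
Variables (F : divRingType) (sigma : {rmorphism F -> F}).
Variable (delta : sderivation sigma).
Implicit Types (f g q : skewpoly delta) (p : {poly F}).

Lemma size_iter_xmul i p : (size (iter i (xmul delta) p) <= i + size p)%N.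
Proof.
elim: i => //= i /leq_sizeP IH; apply/leq_sizeP => j ij; rewrite coef_xmul.
by case: j ij => [|j] ij //=; rewrite !IH ?raddf0 ?addr0 //; lia.
Qed.

(** The [delta] part of [xmul] does not raise the degree, so only [sigma] acts on the top
    coefficient. *)
Lemma coef_iter_xmul_top i d p : (size p <= d.+1)%N ->
  (iter i (xmul delta) p)`_(i + d) = iter i sigma p`_d.
Proof.
move=> pd; elim: i => //= i IH; rewrite coef_xmul /= IH.
rewrite [X in delta X]nth_default ?raddf0 ?addr0 //.
by apply: leq_trans (size_iter_xmul _ _) _; lia.
Qed.

Lemma skew_coefXn i f j : skew_coef (skewX ^+ i * f) j =
  (iter i (xmul delta) (skew_poly f))`_j.
Proof. by rewrite /skew_coef skewX_expr_mul. Qed.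

Lemma size_skew_deg f : f != 0 -> size (skew_poly f) = (skew_deg f).+1.
Proof.
move=> f0; rewrite prednK // lt0n size_poly_eq0.
by apply: contraNneq f0 => fE; apply/eqP/val_inj.
Qed.

(** The order of the matrix depends on [f] and [g]; a free [N] gives Sylvester matrices of different
    pairs the same type. *)
Lemma skew_resultantE f g N : (skew_deg f + skew_deg g)%N = N ->
  skew_resultant f g = ddet (\matrix_(i < N, j < N)
    if (i < skew_deg g)%N then skew_coef (skewX ^+ i * f) j
    else skew_coef (skewX ^+ (i - skew_deg g) * g) j).
Proof. by move <-. Qed.

Lemma skew_resultantC f g : skew_resultant g f =
  dmul (dclass ((-1) ^+ (skew_deg f * skew_deg g))) (skew_resultant f g).
Proof.
set m := skew_deg f; set n := skew_deg g.
case DN : (m + n)%N => [|N].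
  rewrite !(skew_resultantE (N := 0)) /= -/m -/n; try lia.
  by rewrite (_ : (m * n = 0)%N) ?dmul1 //; nia.
rewrite !(skew_resultantE (N := N.+1)) -/m -/n; try lia.
(* The rotation has the parity of [n * N] with [N = m + n - 1], and [n * (n - 1)] is even. *)
have -> : dclass ((-1) ^+ (m * n)) = dclass ((-1) ^+ (rot_perm N ^+ n)%g) :> dab F.
  rewrite odd_rot_perm_exp -signr_odd !oddM.
  have /(congr1 odd) := DN; rewrite oddD oddS.
  by case: (odd m) (odd n) (odd N) => [] [] [].
rewrite -ddet_row_perm; congr ddet; apply/matrixP=> i j; rewrite !mxE rot_perm_expE.
have iN := ltn_ord i; have [im|im] := ltnP i m.
  rewrite modn_small; last by lia.
  by rewrite ltnNge leq_addl /= addnK.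
have -> : (i + n = i - m + N.+1)%N by lia.
rewrite modnDr modn_small; last by lia.
by rewrite ifT //; lia.
Qed.

(** Serves both the sign change, with [d] constantly -1, and left multiplication by [c] when [delta]
    vanishes, with [d i] the [i]-th [sigma]-iterate of [c]. *)
Lemma skew_resultant_scale (d : nat -> F) f f' g : skew_deg f' = skew_deg f ->
    (forall i, d i != 0) ->
    (forall i j, skew_coef (skewX ^+ i * f') j = d i * skew_coef (skewX ^+ i * f) j) ->
  skew_resultant f' g =
    dmul (dclass (\prod_(i < skew_deg g) d i)) (skew_resultant f g).
Proof.
move=> deg_f' d0 f'E; set n := skew_deg g.
pose d' (i : 'I_(skew_deg f + n)) := if (i < n)%N then d i else 1.
have -> : \prod_(i < n) d i = \prod_i d' i.
  by rewrite (big_ord_widen _ d (leq_addl (skew_deg f) n)) big_mkcond.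
rewrite -ddet_row_scales; last by move=> i; rewrite /d'; case: ifP; rewrite ?oner_neq0.
rewrite (@skew_resultantE _ _ (skew_deg f + n)) ?deg_f' //; congr ddet.
by apply/matrixP=> i j; rewrite !mxE /d' -/n; case: ifP => _; rewrite ?f'E ?mul1r.
Qed.

Lemma skew_resultantNl f g : skew_resultant (- f) g =
  dmul (dclass ((-1) ^+ skew_deg g)) (skew_resultant f g).
Proof.
rewrite (@skew_resultant_scale (fun=> -1) f); last 3 first.
- by rewrite /skew_deg /= size_polyN.
- by move=> i; rewrite oppr_eq0 oner_neq0.
- by move=> i j; rewrite mulrN mulN1r /skew_coef coefN.
by rewrite prodr_const card_ord.
Qed.

(** Exchange the arguments, negate on the left, exchange back: the two exchange signs cancel. *)
Lemma skew_resultantNr f g : skew_resultant f (- g) =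
  dmul (dclass ((-1) ^+ skew_deg f)) (skew_resultant f g).
Proof.
rewrite skew_resultantC skew_resultantNl (skew_resultantC f g) !dmulA -!dclassM.
have -> : skew_deg (- g) = skew_deg g by rewrite /skew_deg /= size_polyN.
rewrite -!exprD -[in LHS]signr_odd -[in RHS]signr_odd !oddD !oddM.
by case: (odd _) (odd _) => [] [].
Qed.

Lemma skew_resultant_const f b : b != 0 ->
  skew_resultant f (skewC b) = dclass (\prod_(i < skew_deg f) iter i sigma b).
Proof.
move=> b0; have deg0 : skew_deg (skewC b : skewpoly delta) = 0%N.
  by rewrite /skew_deg /= size_polyC b0.
rewrite (@skew_resultantE _ _ (skew_deg f)) ?deg0 ?addn0 // ddet_lower.
  congr dclass; apply: eq_bigr => i _; rewrite mxE ltn0 subn0 skew_coefXn.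
  by rewrite -{2}[i : nat]addn0 coef_iter_xmul_top ?coefC // size_polyC_leq1.
move=> i j ij; rewrite mxE ltn0 subn0 skew_coefXn nth_default //.
by apply: leq_trans (size_iter_xmul _ _) _; rewrite /= size_polyC b0; lia.
Qed.

(** Right multiplication by [x - a] moves the leading coefficient of [q] up by one degree. The bound
    ensures that the rows coming from [x - a] suffice to form [q (x - a)]. *)
Lemma size_quo_XsubC f q a r : f != 0 -> f = q * (skewX - skewC a) + skewC r ->
  (size (skew_poly q) <= skew_deg f)%N.
Proof.
move=> f0 fE; have [//|] := leqP; move Ds: (size (skew_poly q)) => [//|s] lt_fs.
have := coef_mulX_subC q a s.
rewrite [skew_coef (q * skewC a) _](leq_sizeP _ _ (size_mulC q a)) ?Ds // subr0.
have -> : q * (skewX - skewC a) = f - skewC r by rewrite fE addrK.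
rewrite /skew_coef /= coefD coefN coefC /= subr0 nth_default; last first.
  by rewrite size_skew_deg.
by move/esym/eqP; rewrite -[s]/s.+1.-1 -Ds -lead_coefE lead_coef_eq0 -size_poly_eq0 Ds.
Qed.

Lemma skew_resultant_XsubC f a : f != 0 ->
  skew_resultant f (skewX - skewC a) = dclass (skew_eval f a).
Proof.
move=> f0; have [q fE] := skew_evalP f a; have szq := size_quo_XsubC f0 fE.
set m := skew_deg f in szq; set g := skewX - skewC a in fE *.
have szg : size (skew_poly g) = 2%N by rewrite /= size_XsubC.
have deg1 : skew_deg g = 1%N by rewrite /skew_deg szg.
rewrite (@skew_resultantE _ _ m.+1) ?deg1 ?addn1 //.
(* Row 0 holds [f] and row [k.+1] holds [x^k (x - a)], hence the index shift. *)
pose c (k : 'I_m.+1) := if k == ord0 then 0 else - skew_coef q k.-1.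
set S := \matrix_(i, j) _.
have S0 j : S ord0 j = skew_coef f j by rewrite mxE expr0 mul1r.
have Sl (k : 'I_m) j :
    S (lift ord0 k) j = (iter k (xmul delta) (skew_poly g))`_j.
  by rewrite mxE lift0 ltnS ltn0 subSS subn0 skew_coefXn.
have c0 : c ord0 = 0 by rewrite /c eqxx.
rewrite -(ddet_row_comb S c0); set B := \matrix_(i, j) _.
have B0 j : B ord0 j = if j == ord0 then skew_eval f a else 0.
  rewrite mxE eqxx S0 [in LHS]fE /skew_coef coefD /= (lskewE _ _ szq) coef_sum coefC.
  rewrite big_ord_recl mul0r add0r addrAC -big_split big1 ?add0r //= => k _.
  by rewrite Sl coefZ mulNr subrr.
have Bl (k : 'I_m) j : B (lift ord0 k) j = S (lift ord0 k) j by rewrite mxE.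
rewrite ddet_lower => [|i j].
  (* The other diagonal entries are leading coefficients of [x^k (x - a)], that is, [sigma]-iterates
     of 1. *)
  rewrite big_ord_recl B0 eqxx big1 ?mulr1 // => k _.
  rewrite Bl Sl lift0 -addn1 coef_iter_xmul_top ?szg //.
  by rewrite /= coefB coefX coefC subr0 iter_fix ?rmorph1.
case: (unliftP ord0 i) => [k|] ->; last by rewrite B0; case: eqP => [->|].
rewrite lift0 => kj; rewrite Bl Sl nth_default //.
by apply: leq_trans (size_iter_xmul _ _) _; rewrite szg addn2.
Qed.

(** * Left constant factors when the derivation vanishes *)

Section ZeroDerivation.
Hypothesis delta0 : forall a : F, delta a = 0.

Lemma skewX_expr_mulC i c f :
  skewX ^+ i * (skewC c * f) = skewC (iter i sigma c) * (skewX ^+ i * f).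
Proof.
apply: val_inj; rewrite -[val]/(@skew_poly _ sigma delta) skewC_mul.
rewrite !skewX_expr_mul skewC_mul; elim: i => //= i ->.
by rewrite xmulZ delta0 scale0r addr0.
Qed.

(** The norm multiplies the same factors in the opposite order, so the equality is stated modulo
    commutators. *)
Lemma skewN_prod n c : dclass (skewN delta n c) = dclass (\prod_(i < n) iter i sigma c).
Proof.
have skewNS i : skewN delta i.+1 c = iter i sigma c * skewN delta i c.
  rewrite /= delta0 addr0; elim: i => [|i IH]; first by rewrite rmorph1 mulr1 mul1r.
  by rewrite /= delta0 addr0 {1}IH rmorphM -mulrA.
elim: n => [|n IH]; first by rewrite big_ord0.
by rewrite skewNS big_ord_recr dclassM IH -dclassM dclassC.
Qed.

Lemma skew_resultant_mulC c f g : c != 0 -> skew_resultant (skewC c * f) g =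
  dmul (dclass (skewN delta (skew_deg g) c)) (skew_resultant f g).
Proof.
move=> c0; rewrite skewN_prod; apply: skew_resultant_scale.
- rewrite /skew_deg skewC_mul lreg_size //.
  by apply: mulrI; rewrite dunitE.
- by move=> i; apply: iter_neq0.
- by move=> i j; rewrite skewX_expr_mulC /skew_coef skewC_mul coefZ.
Qed.

End ZeroDerivation.

End SkewResultant.

Theorem proposition3p15 (F : divRingType) (sigma : {rmorphism F -> F})
    (delta : sderivation sigma) (f g : skewpoly delta) (m n : nat)
    (f_neq0 : f != 0) (g_neq0 : g != 0)
    (deg_f : skew_deg f = m) (deg_g : skew_deg g = n) :
  [/\ (* 1 *)
      skew_resultant g f = dmul (dclass ((-1) ^+ (m * n))) (skew_resultant f g),
      (* 2 *)
      skew_resultant (- f) g = dmul (dclass ((-1) ^+ n)) (skew_resultant f g) /\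
      skew_resultant f (- g) = dmul (dclass ((-1) ^+ m)) (skew_resultant f g),
      (* 3 *)
      forall a : F, g = skewX - skewC a ->
        (skew_resultant f g = dclass 0 <-> skew_eval f a = 0) /\
        (a = 0 -> skew_resultant f g = dclass (skew_eval f 0)),
      (* 4 *)
      forall b0 : F, b0 != 0 -> g = skewC b0 ->
        skew_resultant f g = dclass (\prod_(i < m) iter i sigma b0)
    & (* 5 *)
      (forall a : F, delta a = 0) -> forall c : F, c != 0 ->
        skew_resultant (skewC c * f) g =
          dmul (dclass (skewN delta n c)) (skew_resultant f g)].
Proof.
rewrite -deg_f -deg_g; split.
- exact: skew_resultantC.
- by split; [apply: skew_resultantNl | apply: skew_resultantNr].
- move=> a ->; rewrite skew_resultant_XsubC //; split; last by move->.
  exact: dclass_eq0.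
- by move=> b b0 ->; apply: skew_resultant_const.
- by move=> delta0 c c0; apply: skew_resultant_mulC.
Qed.
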